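(* Let $k\in \mathbb{Z}$ and $n,m\in\mathbb{Z}^+$ with $n\geq 2$, $k\not\equiv 0\pmod n$, and $m\geq 1$, and let $T_m$ be the rooted complete $m$-ary tree of infinite height. Then $\chi_{(n,k)}(T_m)=3$ if $(m+1,n)\mid k$, and $\chi_{(n,k)}(T_m)\in\{3,4\}$ otherwise.
   Context: $T_m$ is the infinite rooted tree in which every vertex has exactly $m$ children (so the root has degree $m$ and all other vertices degree $m+1$). $(a,b)$ denotes the greatest common divisor. For a graph $G=(V,E)$, a $\mathbb{Z}$-labeling is a map $\ell:V\to\mathbb{Z}$; its order is the size of its range; it is proper if adjacent vertices get different labels. $N(v)$ is the open neighborhood of $v$. An open coloring with remainder $k \bmod n$ is a labeling with $\sum_{w\in N(v)}\ell(w)\equiv k \pmod n$ for all $v\in V$. $\chi_{(n,k)}(G)$ is the minimum order of a proper open coloring with remainder $k\bmod n$ (when one of finite order exists). *)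

(* Defs.v *)
From HB Require Import structures.
From mathcomp Require Import all_boot all_order all_algebra.
From mathcomp Require Import mathcomp_extra boolp classical_sets functions.
From mathcomp Require Import cardinality fsbigop.

Set Implicit Arguments.
Unset Strict Implicit.
Unset Printing Implicit Defensive.

Import Order.TTheory GRing.Theory Num.Theory.
Local Open Scope classical_set_scope.
Local Open Scope card_scope.
Local Open Scope ring_scope.

(* Local finiteness is part of the structure because neighborhood sums are
   only meaningful when every vertex has finitely many neighbors; the finitely
   supported sum over a set would otherwise return a junk value. *)
Record lfgraph := LFGraph {
  vertex :> choiceType;
  adj : rel vertex;
  adj_sym : symmetric adj;
  adj_irr : irreflexive adj;
  adj_fin : forall v, finite_set [set w | adj v w]
}.

Section Coloring.
Variable G : lfgraph.
Implicit Type l : G -> int.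

Definition open_nbhd (v : G) : set G := [set w | adj v w].

Definition proper l : Prop := forall u v : G, adj u v -> l u <> l v.

Definition has_order l (c : nat) : Prop := range l #= `I_c.

Definition open_coloring (n : nat) (k : int) l : Prop :=
  forall v : G, (\sum_(w \in open_nbhd v) l w = k %[mod n%:Z])%Z.

Definition proper_open_order (n : nat) (k : int) (c : nat) : Prop :=
  exists l, [/\ proper l, open_coloring n k l & has_order l c].

(* [None] means that no proper open coloring of finite order exists. *)
Definition open_chi (n : nat) (k : int) : option nat :=
  if pselect (exists c, `[< proper_open_order n k c >]) is left h
  then Some (ex_minn h) else None.

End Coloring.

(* A vertex of T_m is the list of child indices met on the path from it up to
   the root: the root is [::], and [tree_child u v] says that v is a child of u. *)
Definition tree_child (m : nat) (u v : seq 'I_m) : bool :=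
  [exists i : 'I_m, v == i :: u].

Definition tree_adj (m : nat) : rel (seq 'I_m) :=
  fun u v => tree_child u v || tree_child v u.

Lemma tree_adj_sym (m : nat) : symmetric (@tree_adj m).
Proof. by move=> u v; rewrite /tree_adj orbC. Qed.

Lemma tree_adj_irr (m : nat) : irreflexive (@tree_adj m).
Proof.
move=> u; rewrite /tree_adj orbb; apply/negbTE/existsP => -[i /eqP].
by move/(congr1 size) => /= /n_Sn.
Qed.

Lemma tree_adj_fin (m : nat) (v : seq 'I_m) :
  finite_set [set w | tree_adj v w].
Proof.
apply: (@sub_finite_set _ _
  [set` behead v :: [seq i :: v | i <- enum 'I_m]]); last exact: finite_seq.
move=> w /orP[/existsP[i /eqP ->]|/existsP[i /eqP ->]] /=.
  by rewrite inE map_f ?orbT// mem_enum.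
by rewrite inE eqxx.
Qed.

Definition tree (m : nat) : lfgraph :=
  LFGraph (@tree_adj_sym m) (@tree_adj_irr m) (@tree_adj_fin m).

(* Main.v *)
(** Call a set of vertices perfect when every vertex has exactly one neighbour
    in it.  On T_m such a set is obtained greedily: it omits the root, and the
    first child of a vertex belongs to it unless the parent of that vertex does.
    Labelling it by k and its complement by 0 is then an open coloring with
    remainder k, although not a proper one.  The neighbourhood sums at even
    levels only see the odd levels and conversely, so the even levels can be
    relabelled independently of the odd ones: by the two other integers k + n
    and n in general, which gives 4 labels, or by a single new integer x with
    (m+1) x = k mod n if there is one (every vertex of odd level has degree
    m+1), which gives 3.  Conversely, a proper coloring of order at most 2 takes
    a single value b on the odd levels, so the root gives m b = k and its
    grandchildren (m+1) b = k, whence b = 0 and k = 0 mod n. *)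
Require Import Defs.
From mathcomp Require Import all_boot all_order all_algebra.
From mathcomp Require Import boolp classical_sets.
From mathcomp Require Import cardinality fsbigop zify.

Set Implicit Arguments.
Unset Strict Implicit.
Unset Printing Implicit Defensive.

Import Order.TTheory GRing.Theory Num.Theory.
Local Open Scope classical_set_scope.
Local Open Scope card_scope.
Local Open Scope ring_scope.

Lemma card_eq_seq (T : choiceType) (s : seq T) :
  uniq s -> [set` s] #= `I_(size s).
Proof.
elim: s => [_|x s IHs /= /andP[xs us]].
  suff -> : [set` [::]] = set0 :> set T by rewrite II0.
  by apply/seteqP; split.
apply/eq_cardSP; exists x; first by rewrite /= mem_head.
suff -> : [set` x :: s] `\ x = [set` s] by exact: IHs.
apply/seteqP; split => y /=; rewrite inE.
  by move=> [/orP[/eqP|]].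
by move=> ys; split; [rewrite ys orbT | move=> yx; rewrite -yx ys in xs].
Qed.

Section OpenChi.
Variable G : lfgraph.

Lemma size_le_order (l : G -> int) (c : nat) (s : seq int) :
  has_order l c -> uniq s -> {in s, forall y, range l y} ->
  (size s <= c)%N.
Proof.
move=> lc us sl; rewrite -card_le_II.
have /card_eqPle[_ s1] := card_eq_seq us.
have /card_eqPle[l1 _] := lc.
apply: card_le_trans s1 (card_le_trans _ l1); apply: subset_card_le => x /= xs.
exact: sl.
Qed.

Lemma has_order_seq (l : G -> int) (s : seq int) :
  uniq s -> (forall v, l v \in s) -> {in s, forall y, range l y} ->
  has_order l (size s).
Proof.
move=> us ls sl; rewrite /has_order; suff -> : range l = [set` s].
  exact: card_eq_seq.
by apply/seteqP; split => [x [v _ <-]|]; [exact: ls | exact: sl].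
Qed.

(** Reduces the theorem to one explicit coloring, which also excludes [None], and a lower bound for
    all colorings of finite order. *)
Lemma open_chi_between (n : nat) (k : int) (a b : nat) :
  proper_open_order G n k b -> (forall c, proper_open_order G n k c -> a <= c)%N ->
  exists2 c, open_chi G n k = Some c & (a <= c <= b)%N.
Proof.
move=> ob oa; rewrite /open_chi; case: pselect => [h|[]]; last first.
  by exists b; apply/asboolP.
exists (ex_minn h) => //; case: ex_minnP => c /asboolP oc /(_ b) cb.
by rewrite oa// cb//; apply/asboolP.
Qed.

End OpenChi.

Section Tree.
Variable m : nat.
Implicit Types (v : tree m) (l f g : tree m -> int).

(** The value 0 stands for the missing parent of the root, so that one sum formula covers every
    vertex. *)
Definition parent_term f v : int := if v is _ :: p then f p else 0.

Lemma open_nbhd_sum f v :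
  \sum_(w \in open_nbhd v) f w = parent_term f v + \sum_(i < m) f (i :: v).
Proof.
pose up : seq (tree m) := if v is _ :: p then [:: p] else [::].
pose down : seq (tree m) := [seq (i :: v : seq 'I_m) | i <- enum 'I_m].
have -> : open_nbhd v = [set` up ++ down].
  apply/seteqP; split => w /=; rewrite /open_nbhd /= /tree_adj mem_cat.
    move=> /orP[/existsP[i /eqP ->]|/existsP[i /eqP vE]].
      by rewrite [X in _ || X]map_f ?orbT// mem_enum.
    by rewrite /up vE mem_head.
  move=> /orP[|/mapP[i _ ->]]; last by apply/orP; left; apply/existsP; exists i.
  rewrite /up; case: (v) => [//|i p]; rewrite inE => /eqP ->.
  by apply/orP; right; apply/existsP; exists i.
rewrite -fsbig_seq; last first.
  rewrite cat_uniq; apply/and3P; split; first by rewrite /up; case: (v).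
    apply/hasPn => _ /mapP[i _ ->]; rewrite /up; case: (v) => [//|j p].
    (* A child of [v] is two levels below the parent of [v]. *)
    rewrite inE; apply/eqP => /(congr1 size) /=; lia.
  by rewrite map_inj_uniq ?enum_uniq// => i j [].
rewrite big_cat big_map big_enum /=; congr (_ + _).
by rewrite /up /parent_term; case: (v) => [|i p]; rewrite ?big_nil ?big_seq1.
Qed.

Lemma adj_odd (u v : tree m) : adj u v -> odd (size v) = ~~ odd (size u).
Proof. by move=> /orP[/existsP[i /eqP ->]|/existsP[i /eqP ->]] //=; rewrite negbK. Qed.

Lemma eqz_open_nbhd_sum (n : nat) f g v :
  (forall w, odd (size w) != odd (size v) -> (f w = g w %[mod n%:Z])%Z) ->
  (\sum_(w \in open_nbhd v) f w = \sum_(w \in open_nbhd v) g w %[mod n%:Z])%Z.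
Proof.
move=> fg.
have dvd w : odd (size w) != odd (size v) -> (n%:Z %| f w - g w)%Z.
  by move=> /fg /eqP; rewrite eqz_mod_dvd.
apply/eqP; rewrite eqz_mod_dvd !open_nbhd_sum opprD addrACA -sumrB rpredD//.
  case: v {fg} dvd => [|i p] dvd /=; first by rewrite subr0 rpred0.
  by apply: dvd => /=; case: odd.
by apply: rpred_sum => i _; apply: dvd => /=; case: odd.
Qed.

(** The perfect set: [p] is the grandparent of [i :: u], and its membership excludes the first child
    of [u]. *)
Fixpoint mark (v : seq 'I_m) : bool :=
  if v is i :: u then (i == 0 :> nat) && (if u is _ :: p then ~~ mark p else true)
  else false.

Lemma sum_mark (k : int) v : (0 < m)%N ->
  \sum_(w \in open_nbhd v) (if mark w then k else 0) = k.
Proof.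
(* Only the first child can be marked, and it is marked exactly when the parent of [v] is absent or
   unmarked. *)
move=> m0; rewrite open_nbhd_sum (bigD1 (Ordinal m0))//= big1 ?addr0.
  by case: v => [|i p] /=; rewrite ?add0r//; case: mark; rewrite ?addr0 ?add0r.
by move=> i; rewrite -val_eqE /= => /negbTE ->.
Qed.

Definition level_label (e o : bool -> int) v : int :=
  (if odd (size v) then o else e) (mark v).

Lemma level_label_proper (e o : bool -> int) :
  (forall a b, e a <> o b) -> Defs.proper (level_label e o).
Proof.
move=> eo u v /adj_odd uv; rewrite /level_label uv.
by case: odd => //= /esym; apply: eo.
Qed.

Lemma mem_range_level_label (e o : bool -> int) (b : bool) : (0 < m)%N ->
  (range (level_label e o)) (e b) /\ (range (level_label e o)) (o b).
Proof.
(* Down the branch of first children the marks start with false, true, true, false, so levels 0 to 3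
   meet each parity with each mark. *)
move=> m0; pose i := Ordinal m0.
case: b; split.
- by exists [:: i; i].
- by exists [:: i].
- by exists [::].
- by exists [:: i; i; i].
Qed.

Lemma mark_levels_open_coloring (n : nat) (k : int) (e o : bool -> int) : (0 < m)%N ->
  (forall b, (o b = (if b then k else 0) %[mod n%:Z])%Z) ->
  (forall b, (e b = (if b then k else 0) %[mod n%:Z])%Z) ->
  @open_coloring (tree m) n k (level_label e o).
Proof.
move=> m0 ho he v; rewrite -[in RHS](sum_mark k v m0).
by apply: eqz_open_nbhd_sum => w _; rewrite /level_label; case: odd.
Qed.

Lemma const_even_open_coloring (n : nat) (k x : int) (o : bool -> int) : (0 < m)%N ->
  (forall b, (o b = (if b then k else 0) %[mod n%:Z])%Z) ->
  (x * m.+1%:Z = k %[mod n%:Z])%Z ->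
  @open_coloring (tree m) n k (level_label (fun=> x) o).
Proof.
move=> m0 ho hx v; have [ov|ev] := boolP (odd (size v)); last first.
  rewrite -[in RHS](sum_mark k v m0); apply: eqz_open_nbhd_sum => w.
  by rewrite (negbTE ev) eqbF_neg negbK /level_label => ->.
rewrite -hx (@eqz_open_nbhd_sum n _ (fun=> x)); last first.
  by move=> w; rewrite ov eqb_id /level_label => /negbTE ->.
congr (modz _ _); rewrite open_nbhd_sum sumr_const card_ord.
(* A vertex of odd level is not the root, so its parent contributes one more [x] to the [m] from its
   children. *)
by case: v ov => // i p _ /=; rewrite -mulrS -mulr_natr natz.
Qed.

Lemma exists_modz_gt (n : nat) (x b : int) : (0 < n)%N ->
  exists2 y, b < y & (y = x %[mod n%:Z])%Z.
Proof.
move=> n0; exists ((`|x| + `|b| + 1) * n%:Z + x); first nia.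
by rewrite modzMDl.
Qed.

Lemma proper_open_order3 (n : nat) (k : int) : (0 < m)%N -> (0 < n)%N ->
  k <> 0 -> ((gcdn m.+1 n)%:Z %| k)%Z -> proper_open_order (tree m) n k 3.
Proof.
move=> m0 n0 k0 /dvdzP[q kE]; have [u [w uw]] := Bezoutz m.+1%:Z n%:Z.
(* By Bezout, [q * u] solves the congruence for the even label; moving it above [|k|] within its
   class keeps it apart from 0 and [k]. *)
have [x kx xE] := exists_modz_gt (q * u) `|k| n0.
pose o (b : bool) : int := if b then k else 0.
exists (level_label (fun=> x) o); split.
- by apply: level_label_proper => _ []; rewrite /o; lia.
- apply: const_even_open_coloring => //.
  rewrite -modzMml xE modzMml kE -[(gcdn _ _)%:Z]/(gcdz m.+1%:Z n%:Z) -uw.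
  by rewrite mulrDr !mulrA addrC modzMDl.
- apply: (@has_order_seq (tree m) _ [:: x; k; 0]).
  + by rewrite /= !inE !negb_or; apply/and3P; split=> //; lia.
  + by move=> v; rewrite /level_label /o; case: odd; case: mark; rewrite ?inE ?eqxx ?orbT.
  + by move=> y; rewrite !inE => /or3P[] /eqP ->;
      have [] := mem_range_level_label (fun=> x) o true m0;
      have [] := mem_range_level_label (fun=> x) o false m0.
Qed.

Lemma proper_open_order4 (n : nat) (k : int) : (0 < m)%N -> (0 < n)%N ->
  (k <> 0 %[mod n%:Z])%Z -> proper_open_order (tree m) n k 4.
Proof.
move=> m0 n0 k0.
pose o (b : bool) : int := if b then k else 0.
pose e b := o b + n%:Z.
have eE b : (e b = o b %[mod n%:Z])%Z by rewrite modzDr.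
have neq a b : a != b -> (o a <> o b %[mod n%:Z])%Z.
  by case: a b => -[] // _; exact/nesym/k0.
(* Equal marks give labels that differ by [n]; different marks give labels that differ modulo
   [n]. *)
have eo a b : e a <> o b.
  have [->|/neq ab] := eqVneq a b; first by rewrite /e; lia.
  by move=> /(congr1 (modz^~ n%:Z)); rewrite eE.
have oo : o true != o false by apply/eqP => oo; apply: (neq true false); rewrite ?oo.
have ee : e true != e false by rewrite (inj_eq (addIr _)).
exists (level_label e o); split.
- exact: level_label_proper.
- exact: mark_levels_open_coloring.
- apply: (@has_order_seq (tree m) _ [:: e true; e false; o true; o false]).
  + rewrite /= !inE !negb_or ee oo !andbT /=.
    by do !(apply/andP; split); apply/eqP; [exact: eo true true | exact: eo true false
      | exact: eo false true | exact: eo false false].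
  + by move=> v; rewrite /level_label; case: odd; case: mark; rewrite ?inE ?eqxx ?orbT.
  + by move=> y; rewrite !inE => /or4P[] /eqP ->;
      have [] := mem_range_level_label e o true m0;
      have [] := mem_range_level_label e o false m0.
Qed.

Lemma proper_open_order_ge3 (n : nat) (k : int) (c : nat) : (0 < m)%N ->
  (k <> 0 %[mod n%:Z])%Z -> proper_open_order (tree m) n k c -> (3 <= c)%N.
Proof.
move=> m0 k0 [l [lp lo lc]]; rewrite leqNgt; apply/negP => c3; apply: k0.
pose i := Ordinal m0; pose a := l [::]; pose b := l [:: i].
have adjS (j : 'I_m) (v : tree m) : adj v (j :: v : tree m).
  by apply/orP; left; apply/existsP; exists j.
have ab : a != b by apply/eqP/lp/adjS.
have l2 v : (l v == a) || (l v == b).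
  apply: contraLR c3; rewrite negb_or -leqNgt => /andP[va vb].
  apply: (@size_le_order _ _ _ [:: l v; a; b] lc).
    by rewrite /= !inE negb_or va vb ab.
  by move=> y; rewrite !inE => /or3P[] /eqP ->; apply: imageP.
have lE v : l v = if odd (size v) then b else a.
  elim: v => [//|j v IHv] /=; have /eqP := lp _ _ (adjS j v); rewrite IHv.
  by case/orP: (l2 (j :: v)) => /eqP ->; case: odd => //; rewrite eqxx.
have S0 := lo [::]; have S2 := lo [:: i; i].
(* The vertex [[:: i; i]] sees the same child labels as the root, and in addition its parent,
   labelled [b]. *)
have E2 : (k = b + k %[mod n%:Z])%Z.
  rewrite -S2 -modzDmr -S0 modzDmr; congr (modz _ _).
  rewrite !open_nbhd_sum /= add0r lE; congr (_ + _).
  by apply: eq_bigr => j _; rewrite !lE.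
have b0 : (n%:Z %| b)%Z.
  by move/eqP: E2; rewrite eq_sym eqz_mod_dvd addrK.
apply/eqP; rewrite -S0 eqz_mod_dvd subr0 open_nbhd_sum add0r.
by apply: rpred_sum => j _; rewrite lE.
Qed.

End Tree.

Local Close Scope ring_scope.
Local Close Scope card_scope.
Local Close Scope classical_set_scope.

Theorem theorem6p10 (k : int) (n m : nat) (hn : (2 <= n)%N)
    (hk : (k <> 0 %[mod n%:Z])%Z) (hm : (1 <= m)%N) :
  (((gcdn m.+1 n)%:Z %| k)%Z -> open_chi (tree m) n k = Some 3) /\
  (~ ((gcdn m.+1 n)%:Z %| k)%Z ->
     open_chi (tree m) n k = Some 3 \/ open_chi (tree m) n k = Some 4).
Proof.
have n0 : (0 < n)%N by apply: ltnW.
have ge3 c := @proper_open_order_ge3 m n k c hm hk.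
split => [gk|_].
  have k0 : k <> 0%R by move=> k0; apply: hk; rewrite k0.
  have [c -> c3] := open_chi_between (proper_open_order3 hm n0 k0 gk) ge3.
  by congr Some; lia.
have [c ->] := open_chi_between (proper_open_order4 hm n0 hk) ge3.
by case: c => [|[|[|[|[|c]]]]] // _; [left | right].
Qed.
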